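(* For any Lebesgue-measurable set $A\subseteq\mathbb{B}^2$ such that $0<\Lambda(A)<+\infty$, consider the function $$H(z)=-\int_A \log\frac{(1-|z|^2)(1-|\zeta|^2)}{|1-z\bar\zeta|^2}\, d\Lambda(\zeta),\qquad z\in\mathbb{B}^2.$$ Then the following assertions hold: (1) The function $H$ has a unique global minimum on $\mathbb{B}^2$. (2) The minimum (point) of $H$ is the conformal barycenter of $A$.
   Context: $\mathbb{B}^2=\{z\in\mathbb{C}: |z|<1\}$ is the open unit disc. The hyperbolic measure on $\mathbb{B}^2$ is $d\Lambda(z)=\frac{d\lambda(z)}{(1-|z|^2)^2}$, where $\lambda$ is Lebesgue measure on $\mathbb{C}$. For a Lebesgue-measurable set $A\subseteq\mathbb{B}^2$ with $0<\Lambda(A)<+\infty$, the conformal barycenter of $A$ is the unique point $c\in\mathbb{B}^2$ such that $\int_A \frac{c-z}{1-\bar c z}\, d\Lambda(z)=0$.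
   Formalization: The formal theorem additionally assumes that H(z) is finite for at least one z in the disc; without this there are sets A of finite hyperbolic measure with H identically +∞, for which the minimum is not unique. *)

(* Defs.v *)
From HB Require Import structures.
From mathcomp Require Import all_boot all_order all_algebra.
From mathcomp Require Import complex.
From mathcomp Require Import all_classical all_reals all_analysis.
From mathcomp Require Import measurable_realfun.

Set Implicit Arguments.
Unset Strict Implicit.
Unset Printing Implicit Defensive.

Import Order.TTheory GRing.Theory Num.Theory.
Import numFieldNormedType.Exports.

Local Open Scope classical_set_scope.
Local Open Scope ring_scope.
Local Open Scope complex_scope.

Notation cnorm := ComplexField.Normc.normc.

Section plane_lebesgue.
Variable R : realType.

(* The product of two copies of lebesgue_measure lives on the Borel sets of the
   plane; its Caratheodory extension lives on the Lebesgue-measurable sets. *)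
Definition borel_measure :
    {measure set (measurableTypeR R * measurableTypeR R) -> \bar R} :=
  (@lebesgue_measure R \x @lebesgue_measure R)%E.

Definition plane : Type := caratheodory_type (borel_measure^*)%mu.
HB.instance Definition _ := Measurable.on plane.

Definition lebesgue2 : set plane -> \bar R :=
  @completed_measure_extension _ _ _ borel_measure.
HB.instance Definition _ := Measure.on lebesgue2.

Definition plane_to_C (p : plane) : R[i] := p.1 +i* p.2.

End plane_lebesgue.

Fact lebesgueC_display : measure_display.
Proof. exact: default_measure_display. Qed.

Section complex_lebesgue.
Variable R : realType.

Definition lebesgue_measurableC (A : set R[i]) : Prop :=
  measurable (@plane_to_C R @^-1` A).

Let lebesgue_measurableC0 : lebesgue_measurableC set0.
Proof. by rewrite /lebesgue_measurableC preimage_set0; exact: measurable0. Qed.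

Let lebesgue_measurableCC A :
  lebesgue_measurableC A -> lebesgue_measurableC (~` A).
Proof. by rewrite /lebesgue_measurableC preimage_setC => /measurableC. Qed.

Let lebesgue_measurableC_bigcup (F : (set R[i])^nat) :
  (forall i, lebesgue_measurableC (F i)) ->
  lebesgue_measurableC (\bigcup_i F i).
Proof.
rewrite /lebesgue_measurableC preimage_bigcup => mF.
exact: bigcupT_measurable.
Qed.

HB.instance Definition _ := isPointed.Build R[i] 0.
HB.instance Definition _ := @isMeasurable.Build lebesgueC_display R[i]
  lebesgue_measurableC lebesgue_measurableC0 lebesgue_measurableCC
  lebesgue_measurableC_bigcup.

Lemma measurable_plane_to_C : measurable_fun setT (@plane_to_C R).
Proof. by move=> _ A mA; rewrite setTI. Qed.

Definition lebesgueC : set R[i] -> \bar R :=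
  pushforward (@lebesgue2 R) (@plane_to_C R).

Let lebesgueC_measure : {measure set R[i] -> \bar R} :=
  measure_function_pushforward__canonical__measure_function_Measure
    (@lebesgue2 R) measurable_plane_to_C.

HB.instance Definition _ := isMeasure.Build _ _ _ lebesgueC
  (measure0 lebesgueC_measure) (measure_ge0 lebesgueC_measure)
  (@measure_semi_sigma_additive _ _ _ lebesgueC_measure).

End complex_lebesgue.

Section measurable_complex.
Variable R : realType.

Let measurable_plane_borel (B : set (measurableTypeR R * measurableTypeR R)) :
  measurable B -> measurable (B : set (plane R)).
Proof. exact: caratheodory_measurable_mu_ext. Qed.

Lemma measurable_fun_Re : measurable_fun setT (@complex.Re R).
Proof.
move=> _ B mB; rewrite setTI.
apply: (@measurable_plane_borel (@fst (measurableTypeR R) _ @^-1` B)).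
by rewrite -[X in measurable X]setTI; exact: measurable_fst.
Qed.

Lemma measurable_fun_Im : measurable_fun setT (@complex.Im R).
Proof.
move=> _ B mB; rewrite setTI.
apply: (@measurable_plane_borel (@snd _ (measurableTypeR R) @^-1` B)).
by rewrite -[X in measurable X]setTI; exact: measurable_snd.
Qed.

Lemma measurable_fun_cnorm : measurable_fun setT (fun z : R[i] => cnorm z).
Proof.
rewrite (_ : (fun z => _) =
    Num.sqrt \o (fun z : R[i] => complex.Re z ^+ 2 + complex.Im z ^+ 2));
  last first.
  by apply/funext => -[].
apply: measurableT_comp.
  by apply: continuous_measurable_fun; exact: sqrt_continuous.
by apply: measurable_funD; apply: measurable_funX;
  [exact: measurable_fun_Re|exact: measurable_fun_Im].
Qed.

End measurable_complex.

Section hyperbolic_measure.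
Variable R : realType.

Definition disc : set R[i] := [set z | cnorm z < 1].

Lemma measurable_disc : measurable disc.
Proof.
have := @measurable_fun_cnorm R measurableT _ (measurable_itv `]-oo, 1[).
by rewrite setTI; congr measurable; apply/seteqP; split=> z /=; rewrite in_itv.
Qed.

Definition hyp_density (z : R[i]) : R := ((1 - cnorm z ^+ 2) ^+ 2)^-1.

Lemma hyp_density_ge0 z : 0 <= hyp_density z.
Proof. by rewrite invr_ge0 sqr_ge0. Qed.

Lemma measurable_hyp_density : measurable_fun setT hyp_density.
Proof.
rewrite (_ : hyp_density =
    (@powR R)^~ (-1) \o (fun z => (1 - cnorm z ^+ 2) ^+ 2)); last first.
  by apply/funext => z /=; rewrite powR_inv1 ?sqr_ge0.
apply: measurableT_comp; first exact: measurable_powR.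
apply: measurable_funX; apply: measurable_funB => //.
by apply: measurable_funX; exact: measurable_fun_cnorm.
Qed.

Local Open Scope ereal_scope.

(* hyp_density also takes nonzero values outside the closed disc, hence the
   restriction of the domain of integration. *)
Definition hyp_measure (A : set R[i]) : \bar R :=
  \int[@lebesgueC R]_(z in A `&` disc) (hyp_density z)%:E.

Let hyp_measure0 : hyp_measure set0 = 0.
Proof. by rewrite /hyp_measure set0I integral_set0. Qed.

Let hyp_measure_ge0 A : 0 <= hyp_measure A.
Proof. by apply: integral_ge0 => z _; rewrite lee_fin hyp_density_ge0. Qed.

Let hyp_measure_sigma_additive : semi_sigma_additive hyp_measure.
Proof.
move=> F mF tF mUF.
have mfd : measurable_fun setT (EFin \o hyp_density).
  by apply/measurable_EFinP; exact: measurable_hyp_density.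
have := @semi_sigma_additive_nng_induced _ _ _ (@lebesgueC R) _ mfd.
move=> /(_ _ (fun i => F i `&` disc)).
rewrite -setI_bigcupl; apply.
- by move=> z; rewrite lee_fin hyp_density_ge0.
- by move=> i; apply: measurableI => //; exact: measurable_disc.
- exact: trivIset_setIr.
- by apply: measurableI => //; exact: measurable_disc.
Qed.

HB.instance Definition _ := isMeasure.Build _ _ _ hyp_measure
  hyp_measure0 hyp_measure_ge0 hyp_measure_sigma_additive.

End hyperbolic_measure.

Section conformal_barycenter.
Variable R : realType.
Implicit Types (A : set R[i]) (f : R[i] -> R[i]) (c z w : R[i]).

Definition cintegral (mu : {measure set R[i] -> \bar R}) A f : R[i] :=
  (\int[mu]_(z in A) complex.Re (f z)) +i*
  (\int[mu]_(z in A) complex.Im (f z)).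

Definition barycenter_eq A c : Prop :=
  cintegral (@hyp_measure R) A (fun z => (c - z) / (1 - c^*%C * z)) = 0.

Definition is_conformal_barycenter A c : Prop :=
  unique (fun w => disc w /\ barycenter_eq A w) c.

(* On the disc the logarithm is <= 0, so the value lies in [0, +oo]. For A of
   finite hyperbolic measure it is either finite at every point of the disc or
   +oo at every point of the disc; the latter does happen, when A has enough
   mass near the boundary. *)
Definition log_potential A z : \bar R :=
  (- \int[@hyp_measure R]_(w in A)
      (ln ((1 - cnorm z ^+ 2) * (1 - cnorm w ^+ 2) /
           cnorm (1 - z * w^*%C) ^+ 2))%:E)%E.

Definition is_global_min (H : R[i] -> \bar R) c : Prop :=
  disc c /\ forall z, disc z -> (H c <= H z)%E.

End conformal_barycenter.

(* Main.v *)
Require Import Defs.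
From mathcomp Require Import all_boot all_order all_algebra.
From mathcomp Require Import complex.
From mathcomp Require Import all_classical all_reals all_analysis.
From mathcomp Require Import measurable_realfun ring lra.

Set Implicit Arguments.
Unset Strict Implicit.
Unset Printing Implicit Defensive.

Import Order.TTheory GRing.Theory Num.Theory.
Import numFieldNormedType.Exports.

Local Open Scope classical_set_scope.
Local Open Scope ring_scope.

(* Write phi_c(z) = (c - z) / (1 - conj(c) z). By Moebius invariance of the
   kernel, with u = phi_c(z) and v = phi_c(w),
     H(z) - H(c) = int_A (ln |1 - u conj v|^2 - ln (1 - |u|^2)) dLambda(w).
   The integrand is strictly bounded below by a multiple of Re (u conj v), so H
   has a strict global minimum at any c with int_A phi_c = 0. It is bounded above
   by O(|u|^2) - 2 Re (u conj v), so a minimum point c satisfies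
   int_A phi_c = 0, as one sees by letting u tend to 0 in the direction of this
   integral. A minimum exists because H is continuous and exceeds H(0) near the
   boundary. *)

(** * Modulus estimates in the unit disc *)

Section complex_norm.
Variable R : realType.
Implicit Types z w c u v s : R[i].

Lemma cnorm_ge0 z : 0 <= cnorm z.
Proof. by case: z => a b; exact: sqrtr_ge0. Qed.

Lemma sqr_cnorm z : cnorm z ^+ 2 = complex.Re z ^+ 2 + complex.Im z ^+ 2.
Proof. by case: z => a b /=; rewrite sqr_sqrtr ?addr_ge0 ?sqr_ge0. Qed.

Lemma cnorm_conj z : cnorm z^*%C = cnorm z.
Proof. by case: z => a b /=; rewrite sqrrN. Qed.

Lemma cnormN z : cnorm (- z) = cnorm z.
Proof. by case: z => a b /=; rewrite !sqrrN. Qed.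

Lemma conj_1mul z w : (1 - z^*%C * w)^*%C = 1 - w^*%C * z.
Proof. by case: z w => [a b] [c d] /=; congr (_ +i* _)%C; ring. Qed.

Lemma cnorm_eq0 z : (cnorm z == 0) = (z == 0).
Proof.
apply/eqP/eqP => [|->]; last exact: ComplexField.Normc.normc0.
exact: ComplexField.Normc.eq0_normc.
Qed.

Lemma cnorm_div z w : cnorm (z / w) = cnorm z / cnorm w.
Proof. by rewrite ComplexField.Normc.normcM ComplexField.Normc.normcV. Qed.

Lemma Re_le_cnorm z : `|complex.Re z| <= cnorm z.
Proof.
rewrite -ler_sqr ?nnegrE ?cnorm_ge0// sqr_cnorm real_normK ?num_real//.
by rewrite lerDl sqr_ge0.
Qed.

Lemma Im_le_cnorm z : `|complex.Im z| <= cnorm z.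
Proof.
rewrite -ler_sqr ?nnegrE ?cnorm_ge0// sqr_cnorm real_normK ?num_real//.
by rewrite lerDr sqr_ge0.
Qed.

Lemma cnorm_le_add z : cnorm z <= `|complex.Re z| + `|complex.Im z|.
Proof.
rewrite -ler_sqr ?nnegrE ?cnorm_ge0 ?addr_ge0// sqr_cnorm.
rewrite -(real_normK (num_real (complex.Re z))).
rewrite -(real_normK (num_real (complex.Im z))).
have := normr_ge0 (complex.Re z); have := normr_ge0 (complex.Im z).
by move: `|_| `|_| => a b; nra.
Qed.

Lemma Re_sub1_le_cnorm s : 1 - complex.Re s <= cnorm (1 - s).
Proof.
by apply: le_trans (le_trans (ler_norm _) (Re_le_cnorm _)); case: s.
Qed.

Lemma cnorm_sub1_ge s : 1 - cnorm s <= cnorm (1 - s).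
Proof.
apply: le_trans (Re_sub1_le_cnorm s); rewrite lerD2l lerN2.
exact: le_trans (ler_norm _) (Re_le_cnorm _).
Qed.

Lemma disc_lt1 z : disc z -> cnorm z < 1.
Proof. by []. Qed.

Lemma disc_sqr_gt0 z : disc z -> 0 < 1 - cnorm z ^+ 2.
Proof. by rewrite /disc/= => z1; have := cnorm_ge0 z; nra. Qed.

Lemma discE z : disc z <-> 0 < 1 - cnorm z ^+ 2.
Proof.
split; first exact: disc_sqr_gt0.
by rewrite /disc/= => z1; have := cnorm_ge0 z; nra.
Qed.

Lemma cnormM_conj_lt1 z w : disc z -> disc w -> cnorm (z * w^*%C) < 1.
Proof.
rewrite /disc/= ComplexField.Normc.normcM cnorm_conj => z1 w1.
by have := cnorm_ge0 z; have := cnorm_ge0 w; nra.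
Qed.

Lemma cnorm_1mul_gt0 z w : disc z -> disc w -> 0 < cnorm (1 - z * w^*%C).
Proof.
move=> z1 w1; apply: lt_le_trans (cnorm_sub1_ge _).
by rewrite subr_gt0 cnormM_conj_lt1.
Qed.

Lemma conj_mul_neq1 z w : disc z -> disc w -> 1 - z^*%C * w != 0.
Proof.
move=> z1 w1; rewrite -cnorm_eq0 gt_eqF// mulrC.
exact: cnorm_1mul_gt0.
Qed.

End complex_norm.

(** * Moebius involutions of the disc *)

Section disc_automorphism.
Variable R : realType.
Implicit Types z w c u v s : R[i].

(** With this sign the map exchanges [c] and 0, is its own inverse on the disc, and is exactly the
    integrand of the barycenter equation. *)
Definition mobius c z := (c - z) / (1 - c^*%C * z).

(** Rests on the identity |1 - conj(c) z|^2 - |c - z|^2 = (1 - |c|^2)(1 - |z|^2). *)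
Lemma one_sub_sqr_mobius c z : disc c -> disc z ->
  1 - cnorm (mobius c z) ^+ 2 =
  (1 - cnorm c ^+ 2) * (1 - cnorm z ^+ 2) / cnorm (1 - c^*%C * z) ^+ 2.
Proof.
move=> c1 z1.
have nz : cnorm (1 - c^*%C * z) != 0 by rewrite cnorm_eq0 conj_mul_neq1.
rewrite cnorm_div expr_div_n.
suff -> : cnorm (c - z) ^+ 2 = cnorm (1 - c^*%C * z) ^+ 2
    - (1 - cnorm c ^+ 2) * (1 - cnorm z ^+ 2) by field.
by rewrite !sqr_cnorm; case: c z {c1 z1 nz} => [a b] [x y] /=; ring.
Qed.

Lemma mobius_disc c z : disc c -> disc z -> disc (mobius c z).
Proof.
move=> c1 z1; apply/discE; rewrite one_sub_sqr_mobius//.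
rewrite divr_gt0 ?exprn_gt0 ?mulr_gt0 ?disc_sqr_gt0//.
by rewrite mulrC cnorm_1mul_gt0.
Qed.

Lemma mobiusK c z : disc c -> disc z -> mobius c (mobius c z) = z.
Proof.
move=> c1 z1; have nz := conj_mul_neq1 c1 z1; have nc := conj_mul_neq1 c1 c1.
rewrite /mobius; field; rewrite nz/=.
by have -> : 1 - c^*%C * z - c^*%C * (c - z) = 1 - c^*%C * c by ring.
Qed.

Lemma mobius_eq0 c z : disc c -> disc z -> (mobius c z == 0) = (c == z).
Proof.
move=> c1 z1.
by rewrite mulf_eq0 invr_eq0 (negPf (conj_mul_neq1 c1 z1)) orbF subr_eq0.
Qed.

Lemma cnorm_mobiusC c z : cnorm (mobius c z) = cnorm (mobius z c).
Proof.
rewrite !cnorm_div -(cnormN (c - z)) opprB.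
by rewrite -(cnorm_conj (1 - c^*%C * z)) conj_1mul.
Qed.

Lemma one_sub_mobius_conj c z w : disc c -> disc z -> disc w ->
  1 - mobius c z * (mobius c w)^*%C =
  (1 - c * c^*%C) * (1 - z * w^*%C) / ((1 - c^*%C * z) * (1 - w^*%C * c)).
Proof.
move=> c1 z1 w1; have nz := conj_mul_neq1 c1 z1; have nw := conj_mul_neq1 w1 c1.
rewrite /mobius rmorphM/= rmorphB/= conjc_inv conj_1mul.
by field; rewrite nz nw.
Qed.

End disc_automorphism.

(** * The logarithmic kernel, its Moebius invariance and bounds on its increments *)

Section log_kernel.
Variable R : realType.
Implicit Types (z w c u v s : R[i]) (x y r : R).

Lemma ln_lt_sub1 x : 0 < x -> x != 1 -> ln x < x - 1.
Proof.
move=> x0 x1; rewrite ltrBrDl -[ltRHS]lnK ?posrE// expR_gt1Dx//.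
by rewrite ln_eq0.
Qed.

Lemma ln_le_sub1 x : 0 < x -> ln x <= x - 1.
Proof.
move=> x0; have [->|x1] := eqVneq x 1; first by rewrite ln1 subrr.
exact/ltW/ln_lt_sub1.
Qed.

(** The tangent to [ln] at 1 - r x lies strictly above [ln] at 1 - r and 1 + r. Weighted by 1 + x
    and 1 - x, these two points average to 1 - r x, so the linear terms cancel. *)
Lemma ln_chord_lt r x : 0 < r -> r < 1 -> -1 < x -> x < 1 ->
  (1 + x) * ln (1 - r) + (1 - x) * ln (1 + r) < 2 * ln (1 - r * x).
Proof.
move=> r0 r1 xN1 x1; have p0 : 0 < 1 - r * x by nra.
have tangent y : 0 < y -> y != 1 - r * x ->
    ln y < ln (1 - r * x) + (y / (1 - r * x) - 1).
  move=> y0 yp; rewrite -ltrBlDl -ln_div ?posrE// ln_lt_sub1 ?divr_gt0//.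
  by apply: contra yp => /eqP/divr1_eq ->.
have t1 : ln (1 - r) < ln (1 - r * x) + ((1 - r) / (1 - r * x) - 1).
  by apply: tangent; [lra|apply/eqP; nra].
have t2 : ln (1 + r) < ln (1 - r * x) + ((1 + r) / (1 - r * x) - 1).
  by apply: tangent; [lra|apply/eqP; nra].
rewrite [ltRHS](_ : _ =
  (1 + x) * (ln (1 - r * x) + ((1 - r) / (1 - r * x) - 1)) +
  (1 - x) * (ln (1 - r * x) + ((1 + r) / (1 - r * x) - 1))); last first.
  by field; rewrite gt_eqF.
by apply: ltrD; rewrite ltr_pM2l//; lra.
Qed.

Definition log_ker z w : R :=
  ln ((1 - cnorm z ^+ 2) * (1 - cnorm w ^+ 2) / cnorm (1 - z * w^*%C) ^+ 2).

(** On the disc this is [log_ker 0 v - log_ker u v]. The factor 1 - |v|^2 has cancelled, so for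
    fixed [u] it stays bounded in [v], unlike the kernels themselves. *)
Definition log_gap u v : R :=
  ln (cnorm (1 - u * v^*%C) ^+ 2) - ln (1 - cnorm u ^+ 2).

Lemma log_kerE z w : disc z -> disc w ->
  log_ker z w = ln (1 - cnorm (mobius z w) ^+ 2).
Proof.
move=> z1 w1; rewrite one_sub_sqr_mobius// /log_ker.
by rewrite -(cnorm_conj (1 - z^*%C * w)) conj_1mul (mulrC _ z).
Qed.

Lemma log_ker_le0 z w : disc z -> disc w -> log_ker z w <= 0.
Proof. by move=> z1 w1; rewrite log_kerE// ln_le0// gerBl sqr_ge0. Qed.

(** Moebius invariance moves the base point [c] to 0. After the factors 1 - |w|^2 cancel, both sides
    are logarithms of the same rational expression in moduli. *)
Lemma log_ker_sub c z w : disc c -> disc z -> disc w ->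
  log_ker c w - log_ker z w = log_gap (mobius c z) (mobius c w).
Proof.
move=> c1 z1 w1.
have Ec : cnorm (1 - c * c^*%C) = 1 - cnorm c ^+ 2.
  have -> : 1 - c * c^*%C = ((1 - cnorm c ^+ 2)%:C)%C.
    rewrite sqr_cnorm; case: c {c1} => a b /=.
    by congr (_ +i* _)%C; ring.
  by rewrite /= expr0n addr0 sqrtr_sqr gtr0_norm// disc_sqr_gt0.
have z0 := cnorm_1mul_gt0 z1 w1; have c0 := disc_sqr_gt0 c1.
have cw0 : 0 < cnorm (1 - w^*%C * c) by rewrite mulrC cnorm_1mul_gt0.
have cz0 : 0 < cnorm (1 - c^*%C * z) by rewrite mulrC cnorm_1mul_gt0.
have dw := disc_sqr_gt0 w1; have dz := disc_sqr_gt0 z1.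
rewrite /log_gap one_sub_sqr_mobius// one_sub_mobius_conj// /log_ker.
rewrite cnorm_div !ComplexField.Normc.normcM Ec (mulrC c).
rewrite -!ln_div ?posrE ?(divr_gt0, mulr_gt0, exprn_gt0)//; congr ln.
by field; rewrite !gt_eqF.
Qed.

(** Uses |1 - u conj(v)| >= 1 - |u| and drops the nonnegative term - ln (1 - |u|^2). The bound is
    uniform in [v], which later gives continuity of the potential. *)
Lemma log_gap_ge u v : disc u -> disc v ->
  2 * ln (1 - cnorm u) <= log_gap u v.
Proof.
move=> u1 v1; have u0 := cnorm_ge0 u; have v0 := cnorm_ge0 v.
have := disc_lt1 u1; have := disc_lt1 v1 => lv lu.
have h := cnorm_sub1_ge (u * v^*%C).
rewrite ComplexField.Normc.normcM cnorm_conj in h.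
rewrite /log_gap -[leLHS]subr0 lerB//; last first.
  by rewrite ln_le0// gerBl sqr_ge0.
rewrite lnXn ?cnorm_1mul_gt0// mulr_natl lerMn2r/= ler_ln ?posrE//.
- by apply: le_trans h; nra.
- by rewrite subr_gt0.
- exact: cnorm_1mul_gt0.
Qed.

(** Both logarithms are estimated by ln x <= x - 1, at x = |1 - u conj(v)|^2 and at x = 1 / (1 -
    |u|^2). Only the inner product term is of first order in [u]. *)
Lemma log_gap_le u v : disc u -> disc v ->
  log_gap u v <= cnorm u ^+ 2 / (1 - cnorm u ^+ 2) + cnorm u ^+ 2
                 - 2 * complex.Re (u * v^*%C).
Proof.
move=> u1 v1; have u0 := disc_sqr_gt0 u1.
have uv0 := cnorm_1mul_gt0 u1 v1.
have h1 : ln (cnorm (1 - u * v^*%C) ^+ 2) <=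
    cnorm u ^+ 2 - 2 * complex.Re (u * v^*%C).
  apply: le_trans (ln_le_sub1 _) _; first by rewrite exprn_gt0.
  have -> : cnorm (1 - u * v^*%C) ^+ 2 =
      1 - 2 * complex.Re (u * v^*%C) + cnorm u ^+ 2 * cnorm v ^+ 2.
    by rewrite !sqr_cnorm; case: u v {u1 v1 u0 uv0} => [a b] [x y] /=; ring.
  by have := disc_sqr_gt0 v1; have := sqr_ge0 (cnorm u); nra.
have h2 : - ln (1 - cnorm u ^+ 2) <= cnorm u ^+ 2 / (1 - cnorm u ^+ 2).
  rewrite -lnV ?posrE//; apply: le_trans (ln_le_sub1 _) _.
    by rewrite invr_gt0.
  by rewrite le_eqVlt; apply/orP; left; apply/eqP; field; rewrite gt_eqF.
by rewrite /log_gap; lra.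
Qed.

(* [ln |1 - u conj v|^2] is at least the concave function [2 ln (1 - r x)] of
   [x = Re (u conj v) / r], which lies above the chord joining its values at
   [x = -1] and [x = 1]. *)
Lemma log_gap_gt u v : disc u -> disc v -> u != 0 ->
  (ln (1 - cnorm u) - ln (1 + cnorm u)) / cnorm u * complex.Re (u * v^*%C) <
  log_gap u v.
Proof.
move=> u1 v1 un0; have v0 := cnorm_ge0 v.
have := disc_lt1 u1; have := disc_lt1 v1 => lv lu.
have r0 : 0 < cnorm u by rewrite lt_neqAle cnorm_ge0 eq_sym cnorm_eq0 un0.
pose x := complex.Re (u * v^*%C) / cnorm u.
have Ex : complex.Re (u * v^*%C) = cnorm u * x.
  by rewrite /x; field; rewrite gt_eqF.
have x1 : `|x| < 1.
  rewrite normrM normfV (ger0_norm (cnorm_ge0 _)) ltr_pdivrMr// mul1r.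
  apply: le_lt_trans (Re_le_cnorm _) _.
  by rewrite ComplexField.Normc.normcM cnorm_conj; nra.
have [xN1 {}x1] : -1 < x /\ x < 1 by move: x1; rewrite ltr_norml => /andP.
have h := ln_chord_lt r0 lu xN1 x1.
have p0 : 0 < 1 - cnorm u * x by nra.
have h2 : 2 * ln (1 - cnorm u * x) <= ln (cnorm (1 - u * v^*%C) ^+ 2).
  rewrite lnXn ?cnorm_1mul_gt0// mulr_natl lerMn2r/=.
  by rewrite ler_ln ?posrE ?cnorm_1mul_gt0// -Ex Re_sub1_le_cnorm.
have -> : (ln (1 - cnorm u) - ln (1 + cnorm u)) / cnorm u *
    complex.Re (u * v^*%C) = (ln (1 - cnorm u) - ln (1 + cnorm u)) * x.
  by rewrite Ex; field; rewrite gt_eqF.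
rewrite /log_gap.
(* With r = |u|, this factorization makes the constant term of the chord, ln (1 - r) + ln (1 + r),
   cancel against ln (1 - r^2), leaving the term linear in [x]. *)
have -> : 1 - cnorm u ^+ 2 = (1 - cnorm u) * (1 + cnorm u) by ring.
by rewrite (lnM (x := 1 - cnorm u)) ?posrE ?subr_gt0 ?addr_gt0//; lra.
Qed.

End log_kernel.

(** * Measurability of the kernel and of the Moebius maps *)

Section measurable_complex.
Variable R : realType.
Implicit Types (f g : R[i] -> R[i]) (z c : R[i]) (D : set R[i]).

(** The measurable sets of [R[i]] are the Lebesgue ones, so measurability into [R[i]] would ask for
    more than Borel measurability of the two components, which is what integration uses. *)
Definition measurable_ReIm f :=
  measurable_fun setT (@complex.Re R \o f) /\ measurable_fun setT (@complex.Im R \o f).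

Lemma measurable_ReIm_id : measurable_ReIm id.
Proof. by split; [exact: measurable_fun_Re|exact: measurable_fun_Im]. Qed.

Lemma measurable_ReIm_cst z : measurable_ReIm (fun=> z).
Proof. by split; exact: measurable_cst. Qed.

Lemma measurable_ReImB f g : measurable_ReIm f -> measurable_ReIm g ->
  measurable_ReIm (fun w => f w - g w).
Proof.
move=> [mf1 mf2] [mg1 mg2]; split.
  rewrite (_ : _ \o _ = (@complex.Re R \o f) \- (@complex.Re R \o g)).
    exact: measurable_funB.
  by apply/funext => w /=; case: (f w) (g w) => [? ?] [? ?].
rewrite (_ : _ \o _ = (@complex.Im R \o f) \- (@complex.Im R \o g)).
  exact: measurable_funB.
by apply/funext => w /=; case: (f w) (g w) => [? ?] [? ?].
Qed.

Lemma measurable_ReImM f g : measurable_ReIm f -> measurable_ReIm g ->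
  measurable_ReIm (fun w => f w * g w).
Proof.
move=> [mf1 mf2] [mg1 mg2]; split.
  rewrite (_ : _ \o _ = ((@complex.Re R \o f) \* (@complex.Re R \o g)) \-
                        ((@complex.Im R \o f) \* (@complex.Im R \o g))).
    by apply: measurable_funB; exact: measurable_funM.
  by apply/funext => w /=; case: (f w) (g w) => [? ?] [? ?].
rewrite (_ : _ \o _ = ((@complex.Re R \o f) \* (@complex.Im R \o g)) \+
                      ((@complex.Im R \o f) \* (@complex.Re R \o g))).
  by apply: measurable_funD; exact: measurable_funM.
by apply/funext => w /=; case: (f w) (g w) => [? ?] [? ?].
Qed.

Lemma measurable_ReIm_conj f : measurable_ReIm f ->
  measurable_ReIm (fun w => (f w)^*%C).
Proof.
move=> [mf1 mf2]; split.
  rewrite (_ : _ \o _ = @complex.Re R \o f)//.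
  by apply/funext => w /=; case: (f w).
rewrite (_ : _ \o _ = \- (@complex.Im R \o f)); first exact: measurable_funN.
by apply/funext => w /=; case: (f w).
Qed.

(** On nonnegative reals inversion is the power of exponent -1, even at 0, where both take the value
    0. *)
Lemma measurable_inv_ge0 D (h : R[i] -> R) : (forall w, 0 <= h w) ->
  measurable_fun D h -> measurable_fun D (fun w => (h w)^-1).
Proof.
move=> h0 mh; rewrite (_ : (fun w => _) = (@powR R)^~ (-1) \o h).
  by apply: measurableT_comp mh; exact: measurable_powR.
by apply/funext => w /=; rewrite powR_inv1.
Qed.

Lemma measurable_sqr_cnorm f : measurable_ReIm f ->
  measurable_fun setT (fun w => cnorm (f w) ^+ 2).
Proof.
move=> [mf1 mf2]; under eq_fun do rewrite sqr_cnorm.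
by apply: measurable_funD; exact: measurable_funX.
Qed.

Lemma measurable_ReImV f : measurable_ReIm f ->
  measurable_ReIm (fun w => (f w)^-1).
Proof.
move=> mf; have mN := measurable_inv_ge0 (fun w => sqr_ge0 _)
  (measurable_sqr_cnorm mf).
case: mf => mf1 mf2; split.
  rewrite (_ : _ \o _ = (@complex.Re R \o f) \* (fun w => (cnorm (f w) ^+ 2)^-1)).
    exact: measurable_funM.
  by apply/funext => w /=; rewrite sqr_cnorm; case: (f w).
rewrite (_ : _ \o _ =
    \- ((@complex.Im R \o f) \* (fun w => (cnorm (f w) ^+ 2)^-1))).
  by apply: measurable_funN; exact: measurable_funM.
by apply/funext => w /=; rewrite sqr_cnorm; case: (f w).
Qed.

Lemma measurable_mobius c : measurable_ReIm (mobius c).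
Proof.
apply: measurable_ReImM.
  by apply: measurable_ReImB; [exact: measurable_ReIm_cst|
    exact: measurable_ReIm_id].
apply: measurable_ReImV; apply: measurable_ReImB;
  first exact: measurable_ReIm_cst.
by apply: measurable_ReImM; [exact: measurable_ReIm_cst|
  exact: measurable_ReIm_id].
Qed.

Lemma measurable_log_ker z : measurable_fun setT (log_ker z).
Proof.
apply: (measurableT_comp (@measurable_ln R)); apply: measurable_funM.
  apply: measurable_funM; first exact: measurable_cst.
  apply: measurable_funB; first exact: measurable_cst.
  exact: measurable_sqr_cnorm measurable_ReIm_id.
apply: measurable_inv_ge0 => [w|]; first exact: sqr_ge0.
apply: measurable_sqr_cnorm; apply: measurable_ReImB;
  first exact: measurable_ReIm_cst.
apply: measurable_ReImM; first exact: measurable_ReIm_cst.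
exact: measurable_ReIm_conj measurable_ReIm_id.
Qed.

End measurable_complex.

(** * Integrability of bounded functions and strict positivity of integrals *)

Section integration.
Context d (T : measurableType d) (R : realType).
Variables (mu : {measure set T -> \bar R}) (A : set T).
Hypothesis mA : measurable A.

Lemma le_bound_integrable (f : T -> R) (M : R) : (mu A < +oo)%E ->
  measurable_fun A f -> (forall x, A x -> `|f x| <= M) ->
  mu.-integrable A (EFin \o f).
Proof.
move=> Afin mf fM; apply: measurable_bounded_integrable => //.
exists M; split=> [|y My x Ax]; first exact: num_real.
exact: le_trans (fM x Ax) (ltW My).
Qed.

(** If the integral were 0, [f] would vanish almost everywhere on [A]. As it vanishes nowhere there,
    [A] would lie in a null set. *)
Lemma Rintegral_gt0 (f : T -> R) : (0 < mu A)%E ->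
  mu.-integrable A (EFin \o f) -> (forall x, A x -> 0 < f x) ->
  0 < \int[mu]_(x in A) f x.
Proof.
move=> A0 intf f0; rewrite lt_neqAle Rintegral_ge0 ?andbT; last first.
  by move=> x /f0/ltW.
apply/eqP => f_eq0; have mf := measurable_int mu intf.
have : (\int[mu]_(x in A) `|(f x)%:E| = 0)%E.
  transitivity (\int[mu]_(x in A) (f x)%:E)%E.
    by apply: eq_integral => x /set_mem/f0 fx; rewrite gee0_abs ?lee_fin ?ltW.
  by rewrite -[LHS]fineK -/(Rintegral _ _ _) -?f_eq0//; exact: integrable_fin_num.
move/(ae_eq_integral_abs mu mA mf) => [B [mB B0 AB']].
have AB : A `<=` B.
  by move=> x Ax; apply: AB' => /= /(_ Ax)[fx]; move: (f0 x Ax); rewrite fx ltxx.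
have muA0 : mu A = 0%E by apply/negligibleP => //; exists B.
by rewrite muA0 ltxx in A0.
Qed.

End integration.

(** * The potential as a real function: minimum points versus barycenters *)

Section potential.
Variables (R : realType) (mu : {measure set R[i] -> \bar R}) (A : set R[i]).
Hypotheses (A_disc : A `<=` @disc R) (mA : measurable A).
Hypotheses (A_gt0 : (0 < mu A)%E) (A_fin : (mu A < +oo)%E).
Hypothesis ker_int : exists2 z, disc z & mu.-integrable A (EFin \o log_ker z).
Implicit Types (z w c u v : R[i]).

Let mass := fine (mu A).

Let mass_gt0 : 0 < mass.
Proof. by rewrite fine_gt0// A_gt0. Qed.

Definition potential z : R := - \int[mu]_(w in A) log_ker z w.

Lemma log_gap_bounded u : disc u -> exists M, forall v, disc v ->
  `|log_gap u v| <= M.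
Proof.
(* The summand 2 absorbs the term - 2 Re (u conj(v)), since |u conj(v)| < 1. *)
move=> u1; exists (`|2 * ln (1 - cnorm u)| +
  `|cnorm u ^+ 2 / (1 - cnorm u ^+ 2) + cnorm u ^+ 2 + 2|) => v v1.
have h1 := log_gap_ge u1 v1; have h2 := log_gap_le u1 v1.
have uv : `|complex.Re (u * v^*%C)| <= 1.
  by apply: le_trans (Re_le_cnorm _) _; exact/ltW/cnormM_conj_lt1.
have := ler_norm (- (2 * ln (1 - cnorm u))); rewrite normrN.
have := ler_norm (cnorm u ^+ 2 / (1 - cnorm u ^+ 2) + cnorm u ^+ 2 + 2).
have := normr_ge0 (2 * ln (1 - cnorm u)).
have := normr_ge0 (cnorm u ^+ 2 / (1 - cnorm u ^+ 2) + cnorm u ^+ 2 + 2).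
move: uv; rewrite !ler_norml => /andP[uv1 uv2] *; apply/andP; split; lra.
Qed.

Lemma ker_sub_integrable c z : disc c -> disc z ->
  mu.-integrable A (EFin \o (fun w => log_ker c w - log_ker z w)).
Proof.
move=> c1 z1; have [M hM] := log_gap_bounded (mobius_disc c1 z1).
apply: (le_bound_integrable mA (M := M)) => //.
  by apply: measurable_funTS; apply: measurable_funB; exact: measurable_log_ker.
move=> w /A_disc w1; rewrite log_ker_sub//; apply: hM.
exact: mobius_disc.
Qed.

(** Two kernels differ by a bounded function on a set of finite measure, so integrability at one
    point of the disc spreads to all. *)
Lemma ker_integrable z : disc z -> mu.-integrable A (EFin \o log_ker z).
Proof.
move=> z1; case: ker_int => c c1 ic.
have := integrableB mA ic (ker_sub_integrable c1 z1).
apply: eq_integrable => // w _ /=.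
by rewrite -EFinB; congr (_%:E); lra.
Qed.

Lemma gap_integrable c z : disc c -> disc z ->
  mu.-integrable A (EFin \o (fun w => log_gap (mobius c z) (mobius c w))).
Proof.
move=> c1 z1; apply: eq_integrable (ker_sub_integrable c1 z1) => // w.
by rewrite inE => /A_disc w1 /=; rewrite log_ker_sub.
Qed.

Lemma potential_sub c z : disc c -> disc z ->
  potential z - potential c =
  \int[mu]_(w in A) log_gap (mobius c z) (mobius c w).
Proof.
move=> c1 z1; rewrite /potential opprK addrC -RintegralB//;
  [|exact: ker_integrable..].
by apply: eq_Rintegral => w; rewrite inE => /A_disc w1; rewrite log_ker_sub.
Qed.

Lemma cst_integrable r : mu.-integrable A (EFin \o (fun=> r)).
Proof. exact: (le_bound_integrable mA (M := `|r|)). Qed.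

Lemma mobius_integrable c : disc c ->
  mu.-integrable A (EFin \o (fun w => complex.Re (mobius c w))) /\
  mu.-integrable A (EFin \o (fun w => complex.Im (mobius c w))).
Proof.
move=> c1; have [mRe mIm] := measurable_mobius c.
have m1 w : A w -> cnorm (mobius c w) <= 1.
  by move=> /A_disc w1; exact/ltW/disc_lt1/mobius_disc.
split; apply: (le_bound_integrable mA (M := 1) A_fin).
- exact: measurable_funTS mRe.
- by move=> w /m1; exact: le_trans (Re_le_cnorm _).
- exact: measurable_funTS mIm.
- by move=> w /m1; exact: le_trans (Im_le_cnorm _).
Qed.

Lemma Re_conj_integrable c u : disc c ->
  mu.-integrable A (EFin \o (fun w => complex.Re (u * (mobius c w)^*%C))).
Proof.
move=> c1; have [i1 i2] := mobius_integrable c1.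
have := integrableD mA (integrableZl mA (complex.Re u) i1)
  (integrableZl mA (complex.Im u) i2).
apply: eq_integrable => // w _ /=; rewrite -!EFinM -EFinD; congr (_%:E).
by case: u (mobius c w) => [a b] [x y] /=; ring.
Qed.

(** Re (u conj(v)) is the Euclidean inner product, hence real linear in the components of [v], which
    [cintegral] integrates separately. *)
Lemma Rintegral_Re_conj c u : disc c ->
  \int[mu]_(w in A) complex.Re (u * (mobius c w)^*%C) =
  complex.Re (u * (cintegral mu A (mobius c))^*%C).
Proof.
move=> c1; have [i1 i2] := mobius_integrable c1.
transitivity (\int[mu]_(w in A) (complex.Re u * complex.Re (mobius c w) +
    complex.Im u * complex.Im (mobius c w))).
  apply: eq_Rintegral => w _.
  by case: u (mobius c w) => [a b] [x y] /=; ring.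
rewrite RintegralD//; [|exact: (integrableZl mA _ i1)
  |exact: (integrableZl mA _ i2)].
rewrite !RintegralZl// /cintegral.
by case: u => a b /=; ring.
Qed.

(** The lower bound of [log_gap_gt] integrates to 0 by the barycenter equation; subtracting it
    leaves a strictly positive integrand. The strictness yields uniqueness of both the minimum point
    and the barycenter. *)
Lemma barycenter_potential_lt c z : disc c -> disc z -> z != c ->
  cintegral mu A (mobius c) = 0 -> potential c < potential z.
Proof.
move=> c1 z1 zc V0; rewrite -subr_gt0 potential_sub//.
set u := mobius c z; have u1 : disc u by exact: mobius_disc.
have un0 : u != 0 by rewrite mobius_eq0// eq_sym.
set k := (ln (1 - cnorm u) - ln (1 + cnorm u)) / cnorm u.
have ik : mu.-integrable A
    (EFin \o (fun w => k * complex.Re (u * (mobius c w)^*%C))).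
  exact: (integrableZl mA _ (Re_conj_integrable u c1)).
have Ik : \int[mu]_(w in A) (k * complex.Re (u * (mobius c w)^*%C)) = 0.
  rewrite RintegralZl//; last exact: Re_conj_integrable.
  by rewrite Rintegral_Re_conj// V0 conjc0 mulr0/= mulr0.
rewrite -[ltRHS]subr0 -[X in _ - X]Ik -RintegralB//; last first.
  exact: gap_integrable.
apply: Rintegral_gt0 => //.
  exact: (integrableB mA (gap_integrable c1 z1) ik).
move=> w /A_disc w1; rewrite subr_gt0; apply: log_gap_gt => //.
exact: mobius_disc.
Qed.

Lemma potential_min_barycenter c : disc c ->
  (forall z, disc z -> potential c <= potential z) ->
  cintegral mu A (mobius c) = 0.
Proof.
move=> c1 cmin; set V := cintegral _ _ _.
apply/eqP; rewrite -cnorm_eq0; apply/eqP/le_anti; rewrite cnorm_ge0 andbT leNgt.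
apply/negP => V0; set S := cnorm V.
(* Small enough that t S <= 1/2 and 3 t mass < 1. The test point is [mobius c u] with u = t V: the
   gain 2 t S^2 is of first order in t, the error q * mass of second order. *)
pose t : R := (3 * mass + 2 * S + 2)^-1.
have den : 0 < 3 * mass + 2 * S + 2 by rewrite !addr_gt0// mulr_gt0.
have t0 : 0 < t by rewrite invr_gt0.
have tden : t * (3 * mass) + t * (2 * S) + t * 2 = 1.
  by rewrite -!mulrDr mulVf// gt_eqF.
pose u : R[i] := (t%:C)%C * V.
have Eu : cnorm u = t * S.
  by rewrite ComplexField.Normc.normcM /= expr0n addr0 sqrtr_sqr gtr0_norm.
have tm : 0 < t * mass by rewrite mulr_gt0.
have tS : 0 < t * S by rewrite mulr_gt0.
have tS2 : t * S <= 1/2 by lra.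
have u1 : disc u by change (is_true (cnorm u < 1)); rewrite Eu; lra.
have := cmin _ (mobius_disc c1 u1); apply/negP; rewrite -ltNge -subr_lt0.
rewrite potential_sub ?mobiusK//; last exact: mobius_disc.
set q := cnorm u ^+ 2 / (1 - cnorm u ^+ 2) + cnorm u ^+ 2.
apply: (@le_lt_trans _ _ (\int[mu]_(w in A)
    (q - 2 * complex.Re (u * (mobius c w)^*%C)))).
  have i2 := integrableZl mA 2 (Re_conj_integrable u c1).
  apply: le_Rintegral => //.
  - have := gap_integrable c1 (mobius_disc c1 u1).
    by rewrite mobiusK.
  - exact: (integrableB mA (cst_integrable q) i2).
  - by move=> w /A_disc w1; apply: log_gap_le => //; exact: mobius_disc.
rewrite RintegralB//; [|exact: cst_integrable
  |exact: (integrableZl mA 2 (Re_conj_integrable u c1))].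
rewrite Rintegral_cst// RintegralZl//; last exact: Re_conj_integrable.
rewrite Rintegral_Re_conj// -/V -/mass.
have -> : complex.Re (u * V^*%C) = t * S ^+ 2.
  by rewrite /S sqr_cnorm /u; move: (V) (t) => [a b] ? /=; ring.
(* For x = t S <= 1/2, the fraction x^2 / (1 - x^2) is at most 2 x^2; this is the origin of the
   factor 3 in [t]. *)
have q3 : q <= 3 * (t * S) ^+ 2.
  rewrite /q Eu; move: (t * S) tS tS2 => x x0 xle.
  have x4 : x ^+ 2 <= 1/4 by nra.
  suff : x ^+ 2 / (1 - x ^+ 2) <= 2 * x ^+ 2 by lra.
  by rewrite ler_pdivrMr; nra.
have qm : q * mass <= 3 * (t * S) ^+ 2 * mass by rewrite ler_wpM2r// ltW.
apply: le_lt_trans (lerB qm (lexx _)) _.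
have -> : 3 * (t * S) ^+ 2 * mass - 2 * (t * S ^+ 2) =
  (t * S) * S * (t * (3 * mass) - 2) by ring.
by rewrite pmulr_rlt0 ?mulr_gt0//; lra.
Qed.

Lemma potential_sub_ge c z : disc c -> disc z ->
  2 * ln (1 - cnorm (mobius c z)) * mass <= potential z - potential c.
Proof.
move=> c1 z1; rewrite potential_sub// -Rintegral_cst//.
apply: le_Rintegral => //; first exact: cst_integrable.
  exact: gap_integrable.
by move=> w /A_disc w1; apply: log_gap_ge; exact: mobius_disc.
Qed.

(** The one-sided bound is used in both directions; it is symmetric because |phi_c(z)| =
    |phi_z(c)|. *)
Lemma potential_dist c z : disc c -> disc z ->
  `|potential c - potential z| <= - (2 * ln (1 - cnorm (mobius c z)) * mass).
Proof.
move=> c1 z1; have := potential_sub_ge z1 c1; have := potential_sub_ge c1 z1.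
by rewrite (cnorm_mobiusC z) ler_norml; set a := _ * _ * _; lra.
Qed.

End potential.

(** * Existence of a minimum: coercivity, continuity, compactness *)

Section existence.
Variables (R : realType) (mu : {measure set R[i] -> \bar R}) (A : set R[i]).
Hypotheses (A_disc : A `<=` @disc R) (mA : measurable A).
Hypotheses (A_gt0 : (0 < mu A)%E) (A_fin : (mu A < +oo)%E).
Hypothesis ker_int : exists2 z, disc z & mu.-integrable A (EFin \o log_ker z).
Implicit Types (z w c u v : R[i]).

Lemma measurable_core (e : R) :
  measurable (A `&` [set w | e <= 1 - cnorm w ^+ 2]%R).
Proof.
apply: measurableI => //.
have mf : measurable_fun setT (fun w : R[i] => 1 - cnorm w ^+ 2).
  apply: measurable_funB; first exact: measurable_cst.
  exact: measurable_sqr_cnorm (measurable_ReIm_id R).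
have := mf measurableT _ (measurable_itv `[e, +oo[).
rewrite setTI; congr measurable; apply/seteqP; split=> w /=;
  by rewrite in_itv/= andbT.
Qed.

(** The sets with e = 1/(n+1) exhaust [A]; if all were null, so would be [A]. *)
Lemma core_measure_gt0 : exists2 e : R, 0 < e &
  (0 < mu (A `&` [set w | e <= 1 - cnorm w ^+ 2]%R))%E.
Proof.
apply: contrapT => h.
pose B n := A `&` [set w | n.+1%:R^-1 <= 1 - cnorm w ^+ 2].
have B0 n : mu.-negligible (B n).
  apply/negligibleP; first exact: measurable_core.
  apply/eqP; rewrite -measure_le0 leNgt; apply/negP => Bn.
  by apply: h; exists n.+1%:R^-1 => //; rewrite invr_gt0.
have A0 : mu A = 0%E.
  apply/negligibleP => //; apply: negligibleS (negligible_bigcup B0) => w Aw.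
  have w0 := disc_sqr_gt0 (A_disc Aw).
  exists (Num.truncn (1 - cnorm w ^+ 2)^-1) => //; split => //=.
  by rewrite invf_ple ?posrE//; exact/ltW/truncnS_gt.
by move: A_gt0; rewrite A0 ltxx.
Qed.

(* Near the boundary, the part of [A] in a fixed smaller disc already pushes the
   potential above its value at 0. *)
Lemma potential_coercive : exists2 e : R, 0 < e & forall z, disc z ->
  1 - cnorm z ^+ 2 < e -> potential mu A 0 < potential mu A z.
Proof.
have [d d0 muB] := core_measure_gt0; set B := A `&` _ in muB.
have mB : measurable B by exact: measurable_core.
have BA : B `<=` A by move=> w [].
have Bfin : (mu B < +oo)%E.
  by apply: le_lt_trans A_fin; apply: le_measure; rewrite ?inE.
pose m := fine (mu B).
have m0 : 0 < m by rewrite fine_gt0// muB.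
pose h0 := potential mu A 0.
(* On [B] the denominator of the kernel is at least (d/2)^2, so this bound on 1 - |z|^2 forces the
   kernel below -(h0 + 1)/m there. Integrating over [B] brings the potential to at least h0 + 1. *)
exists ((d / 2) ^+ 2 * expR (- ((h0 + 1) / m))).
  by rewrite mulr_gt0 ?expR_gt0// exprn_gt0// divr_gt0.
move=> z z1 ze; have dz := disc_sqr_gt0 z1.
have int_z : mu.-integrable A (EFin \o log_ker z) by exact: ker_integrable.
have int_B : mu.-integrable B (EFin \o log_ker z) by exact: integrableS int_z.
have ker_B w : B w -> log_ker z w <= - ((h0 + 1) / m).
  move=> [/A_disc w1 /= dw]; have w0 := cnorm_ge0 w; have lw := disc_lt1 w1.
  (* Here |1 - z conj(w)| >= 1 - |w| >= (1 - |w|^2)/2 >= d/2. *)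
  have zw : d / 2 <= cnorm (1 - z * w^*%C).
    apply: le_trans (cnorm_sub1_ge _).
    rewrite ComplexField.Normc.normcM cnorm_conj.
    by have := disc_lt1 z1; have := cnorm_ge0 z; nra.
  rewrite /log_ker -[leRHS]expRK ler_ln ?posrE ?expR_gt0//; last first.
    by rewrite divr_gt0 ?exprn_gt0 ?cnorm_1mul_gt0 ?mulr_gt0 ?disc_sqr_gt0.
  rewrite ler_pdivrMr ?exprn_gt0 ?cnorm_1mul_gt0//.
  have e0 := expR_gt0 (- ((h0 + 1) / m)).
  apply: (@le_trans _ _ (1 - cnorm z ^+ 2)).
    by rewrite ger_pMr// gerBl sqr_ge0.
  apply/ltW/(lt_le_trans ze); rewrite mulrC ler_wpM2l ?(ltW e0)//.
  by rewrite ler_sqr ?nnegrE ?cnorm_ge0 ?divr_ge0 ?(ltW d0).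
(* The kernel is nonpositive, so a larger domain lowers its integral; the factor -1 reduces this to
   monotonicity for nonnegative integrands. *)
have le_AB : \int[mu]_(w in A) log_ker z w <= \int[mu]_(w in B) log_ker z w.
  suff : \int[mu]_(w in B) (-1 * log_ker z w) <=
         \int[mu]_(w in A) (-1 * log_ker z w).
    by rewrite (RintegralZl _ mA int_z) (RintegralZl _ mB int_B) !mulN1r lerN2.
  apply: fine_le.
  - exact: integrable_fin_num (integrableZl mB (-1) int_B).
  - exact: integrable_fin_num (integrableZl mA (-1) int_z).
  apply: ge0_subset_integral => //.
    exact: measurable_int (integrableZl mA (-1) int_z).
  by move=> w /A_disc w1; rewrite lee_fin mulN1r oppr_ge0 log_ker_le0.
have le_B : \int[mu]_(w in B) log_ker z w <= - ((h0 + 1) / m) * m.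
  rewrite -Rintegral_cst//; apply: le_Rintegral => //.
  exact: (le_bound_integrable mB (M := `|- ((h0 + 1) / m)|) Bfin).
rewrite -/h0 /potential; have : - ((h0 + 1) / m) * m = - (h0 + 1).
  by field; rewrite gt_eqF.
lra.
Qed.

(** Continuity and compactness are treated in the product topology of [R * R], where closed squares
    are compact. *)
Let pt (p : R * R) : R[i] := (p.1 +i* p.2)%C.

Lemma potential_continuous (p : R * R) : disc (pt p) ->
  {for p, continuous (potential mu A \o pt)}.
Proof.
move=> p1; set M := fine (mu A); have M0 : 0 < M by rewrite fine_gt0// A_gt0.
have k0 : 0 < 1 - cnorm (pt p) by rewrite subr_gt0.
apply/cvgrPdist_lt => e e0.
(* Target bound for t = |phi_p(q)|: with t < s <= 1/2 one has - ln (1 - t) <= 2 t, so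
   [potential_dist] gives at most 4 M s < e. *)
pose s : R := Num.min (1/2) (e / (4 * M + 1)).
have s0 : 0 < s by rewrite lt_min divr_gt0//= divr_gt0// addr_gt0// mulr_gt0.
have s2 : s <= 1/2 by rewrite ge_min lexx.
have sM : 4 * M * s < e.
  have : s <= e / (4 * M + 1) by rewrite ge_min lexx orbT.
  by rewrite ler_pdivlMr ?addr_gt0 ?mulr_gt0//; lra.
(* Then |p - q| < 2 d = (1 - |p|) s, while |1 - conj(p) q| >= 1 - |p|, so |phi_p(q)| < s. *)
pose d : R := (1 - cnorm (pt p)) * s / 2.
have d0 : 0 < d by rewrite /d divr_gt0// mulr_gt0.
near=> q.
have [q1 q2] : ball p d q by near: q; exact: nbhsx_ballx p d d0.
rewrite /ball/= in q1 q2.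
have pq : cnorm (pt p - pt q) < 2 * d.
  apply: le_lt_trans (cnorm_le_add _) _.
  by rewrite /= (_ : 2 * d = d + d) ?ltrD//; ring.
have dE : 2 * d = (1 - cnorm (pt p)) * s by rewrite /d; field.
have qd : disc (pt q).
  rewrite -[disc _]/(is_true (cnorm (pt q) < 1)).
  have -> : pt q = pt p - (pt p - pt q) by rewrite opprB addrC subrK.
  apply: le_lt_trans (le_normcD (pt p) (- (pt p - pt q))) _; rewrite cnormN.
  by nra.
have t1 : cnorm (mobius (pt p) (pt q)) < s.
  rewrite cnorm_div ltr_pdivrMr; last by rewrite mulrC cnorm_1mul_gt0.
  apply: lt_le_trans pq _; rewrite dE mulrC ler_wpM2l ?(ltW s0)//.
  apply: le_trans (cnorm_sub1_ge _).
  rewrite ComplexField.Normc.normcM cnorm_conj.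
  by have := disc_lt1 qd; have := cnorm_ge0 (pt p); nra.
have t0 := cnorm_ge0 (mobius (pt p) (pt q)).
apply: le_lt_trans (potential_dist A_disc mA A_fin ker_int p1 qd) _.
move: (cnorm (mobius _ _)) t0 t1 => t t0 t1.
rewrite -/M; have lnt : - ln (1 - t) <= 2 * t.
  rewrite -lnV ?posrE; last lra.
  apply: le_trans (ln_le_sub1 _) _; first by rewrite invr_gt0; lra.
  rewrite lerBlDr -div1r ler_pdivrMr; [nra|lra].
have : - ln (1 - t) * M <= 2 * t * M by rewrite ler_wpM2r// ltW.
have : t * M <= s * M by rewrite ler_wpM2r// ltW.
lra.
Unshelve. all: by end_near.
Qed.

(** A polynomial sublevel set, hence closed, lying in the square [-1, 1]^2 because r >= 0. *)
Lemma compact_closed_disc (r : R) : 0 <= r ->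
  compact [set p : R * R | r <= 1 - cnorm (pt p) ^+ 2].
Proof.
move=> r0; set K := [set p | _].
have closedK : closed K.
  rewrite (_ : K = (fun p : R * R => p.1 * p.1 + p.2 * p.2) @^-1`
      [set x | x <= 1 - r]).
    apply: preimage_closed; last exact: closed_le.
    by move=> p _; apply: cvgD; apply: cvgM;
      by [exact: cvg_fst|exact: cvg_snd].
  apply/seteqP; split => p; rewrite /K/= sqr_sqrtr ?addr_ge0 ?sqr_ge0//.
    by rewrite !expr2; lra.
  by rewrite !expr2; lra.
have subK : K `<=` `[-1, 1]%classic `*` `[-1, 1]%classic.
  move=> p; rewrite /K/= sqr_sqrtr ?addr_ge0 ?sqr_ge0// !in_itv/= => h.
  by split; apply/andP; split; nra.
apply: subclosed_compact closedK _ subK.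
by apply: compact_setX; exact: segment_compact.
Qed.

Lemma potential_has_min :
  exists2 c, disc c & forall z, disc z -> potential mu A c <= potential mu A z.
Proof.
have [e e0 he] := potential_coercive.
have d0 : disc (0 : R[i]) by rewrite /disc/= expr0n addr0 sqrtr0.
pose K := [set p : R * R | e <= 1 - cnorm (pt p) ^+ 2].
(* Otherwise coercivity at 0 would make the potential at 0 smaller than itself. Hence the minimum
   over [K] is at most the value at 0, which is exceeded outside [K]. *)
have K0 : K (0, 0).
  rewrite /K/= leNgt; apply/negP => h.
  by have := he _ d0 h; rewrite ltxx.
have Kdisc p : K p -> disc (pt p).
  by move=> /= Kp; apply/discE; exact: lt_le_trans Kp.
have [] := @compact_EVT_min _ _ (potential mu A \o pt) K.
- by exists (0, 0).
- exact: compact_closed_disc (ltW e0).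
- apply: continuous_in_subspaceT => p; rewrite inE => /Kdisc.
  exact: potential_continuous.
move=> c; rewrite inE => Kc cmin; exists (pt c); first exact: Kdisc.
move=> z z1; have [ze|ze] := ltP (1 - cnorm z ^+ 2) e.
  apply: le_trans (ltW (he _ z1 ze)).
  by apply: (cmin (0, 0)); rewrite inE.
have -> : z = pt (complex.Re z, complex.Im z) by case: z {z1 ze}.
by apply: cmin; rewrite inE /K/=; case: z ze {z1}.
Qed.

End existence.

Theorem theorem1p3 (R : realType) (A : set R[i]) (A_sub : A `<=` @disc R)
    (mA : measurable A) (A_gt0 : (0 < hyp_measure A)%E)
    (A_fin : (hyp_measure A < +oo)%E)
    (H_fin : exists2 z, disc z & (log_potential A z < +oo)%E) :
  (exists! c, is_global_min (log_potential A) c) /\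
  (forall c, is_global_min (log_potential A) c -> is_conformal_barycenter A c).
Proof.
have ker_int : exists2 z, disc z &
    (@hyp_measure R).-integrable A (EFin \o log_ker z).
  case: H_fin => z z1 Hz; exists z => //; apply/integrableP; split.
    by apply/measurable_EFinP; apply: measurable_funTS; exact: measurable_log_ker.
  apply: le_lt_trans Hz.
  (* The kernel is written as the opposite of a nonnegative function so that [integral_ge0N]
     applies; the finite value of [log_potential] at [z] is then the integral of the absolute
     kernel. *)
  rewrite (_ : log_potential A z =
    - \int[@hyp_measure R]_(w in A) (- (- log_ker z w)%:E))%E; last first.
    by rewrite /log_potential; congr (- _)%E; apply: eq_integral => w _;
      rewrite -EFinN opprK.
  have K0 w : w \in A -> 0 <= - log_ker z w.
    by rewrite inE => /A_sub w1; rewrite oppr_ge0 log_ker_le0.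
  rewrite integral_ge0N ?oppeK => [|w /mem_set/K0]; last by rewrite lee_fin.
  rewrite le_eqVlt; apply/orP; left; apply/eqP/eq_integral => w /K0 w0 /=.
  by rewrite -normrN ger0_norm.
have HE z : disc z -> log_potential A z = (potential (@hyp_measure R) A z)%:E.
  move=> z1; rewrite /log_potential /potential EFinN; congr (- _)%E.
  rewrite fineK//; apply: integrable_fin_num => //.
  exact: (ker_integrable A_sub mA A_fin ker_int z1).
have minE c : is_global_min (log_potential A) c <-> disc c /\ forall z, disc z ->
    potential (@hyp_measure R) A c <= potential (@hyp_measure R) A z.
  split=> -[c1 cmin]; split=> // z z1; have := cmin z z1.
    by rewrite !HE// lee_fin.
  by rewrite !HE// lee_fin.
have min_bary c : is_global_min (log_potential A) c ->
    disc c /\ barycenter_eq A c.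
  move=> /minE[c1 cmin]; split=> //.
  exact: (potential_min_barycenter A_sub mA A_gt0 A_fin ker_int c1 cmin).
(* Used twice: for uniqueness of the minimum point, each minimum being a barycenter, and for
   uniqueness of the barycenter. *)
have bary_min c w : disc c -> barycenter_eq A c ->
    is_global_min (log_potential A) w -> c = w.
  move=> c1 Ec /minE[w1 wmin]; apply/eqP; apply: contraT => cw.
  have := barycenter_potential_lt A_sub mA A_gt0 A_fin ker_int c1 w1 _ Ec.
  by rewrite eq_sym => /(_ cw); rewrite ltNge wmin.
split.
  have [c c1 cmin] := potential_has_min A_sub mA A_gt0 A_fin ker_int.
  have cM : is_global_min (log_potential A) c by apply/minE.
  by exists c; split=> // w; have [_] := min_bary _ cM; exact: bary_min.
move=> c cM; split; first exact: min_bary.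
by move=> w [w1 Ew]; rewrite (bary_min w c).
Qed.
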